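(* For every $n\ge 1$, $$\left|ASM^{\circ}_{n,4}\right|=\prod_{k=0}^{2n-1}\frac{(3k+1)!}{(2n+k)!}.$$
   Context: For $n,k\ge1$, $ASM^{\circ}_{n,k}$ (chained circular alternating sign matrices) is the set of $k$-tuples $(A^{(1)},\dots,A^{(k)})$ of $n\times n$ matrices with entries in $\{-1,0,1\}$ satisfying: (1) $\sum_{j=1}^m A^{(\ell)}_{i,j}\in\{0,1\}$ for all $1\le i\le n$, $1\le m\le n$, $1\le\ell\le k$; (2) $\sum_{j=1}^n A^{(\ell-1)}_{i,j}+\sum_{j=1}^m A^{(\ell)}_{n+1-j,i}\in\{0,1\}$ for all $1\le i\le n$, $1\le m\le n$, $1\le\ell\le k$, where $A^{(0)}=A^{(k)}$; (3) the sum of all entries $\sum_{i,j,\ell}A^{(\ell)}_{i,j}$ is maximum among all such $k$-tuples satisfying (1) and (2). *)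

(* Defs.v *)
From mathcomp Require Import all_boot all_order all_algebra.

Set Implicit Arguments.
Unset Strict Implicit.
Unset Printing Implicit Defensive.

Import Order.TTheory GRing.Theory Num.Theory.
Local Open Scope ring_scope.

(* A subtype of int, so as to be a finType. *)
Definition sign_entry : finType := seq_sub [:: -1; 0; 1 : int].

(* All indices are 0-based: the row, column and tuple positions 1..n, 1..n
   and 1..k are the ordinals of 'I_n, 'I_n and 'I_k. *)
Definition entry (n k : nat) (A : k.-tuple 'M[sign_entry]_n)
    (l : 'I_k) (i j : 'I_n) : int :=
  val (tnth A l i j).

(* The sum of the first m entries of a row, 1 <= m <= n, becomes the sum over
   j <= m with m : 'I_n. *)
Definition row_partial_sums (n k : nat)
    (A : k.-tuple 'M[sign_entry]_n) : bool :=
  [forall l : 'I_k, forall i : 'I_n, forall m : 'I_n,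
    \sum_(j < n | (j <= m)%N) entry A l i j \in [:: 0; 1]].

(* Row i of A^(l-1) continues into column i of A^(l), read from bottom to top:
   rev_ord turns the 1-based row n+1-j into its 0-based index.  The
   predecessor ord_pred is cyclic, which is the convention A^(0) = A^(k). *)
Definition chained_partial_sums (n k : nat)
    (A : k.-tuple 'M[sign_entry]_n) : bool :=
  [forall l : 'I_k, forall i : 'I_n, forall m : 'I_n,
    \sum_(j < n) entry A (ord_pred l) i j
      + \sum_(j < n | (j <= m)%N) entry A l (rev_ord j) i \in [:: 0; 1]].

Definition chained (n k : nat) (A : k.-tuple 'M[sign_entry]_n) : bool :=
  row_partial_sums A && chained_partial_sums A.

Definition total_sum (n k : nat) (A : k.-tuple 'M[sign_entry]_n) : int :=
  \sum_(l < k) \sum_(i < n) \sum_(j < n) entry A l i j.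

Definition chained_circular_ASM (n k : nat) :
    {set k.-tuple 'M[sign_entry]_n} :=
  [set A | chained A &
    [forall B : k.-tuple 'M[sign_entry]_n,
      chained B ==> (total_sum B <= total_sum A)]].

(* Main.v *)
(* Laying the four matrices of a chained tuple, suitably rotated, as the
   quadrants of a 2n x 2n matrix turns the chained lines into its rows and
   columns.  The sum of all entries is half the sum of the line totals, hence
   maximal exactly when every line sums to 1: the tuples counted here are the
   alternating sign matrices of size N = 2n.

   These are counted with the six-vertex model at a primitive cube root of
   unity z (Kuperberg; Okada and Stroganov for the Schur function).  With
   row parameters x and column parameters y, the partition function Z is
   symmetric in the y's by the Yang-Baxter equation, has degree at most N - 1
   in the first x, and factors at x = z y, where a corner is frozen.  The
   determinant of the alternant with exponents 0, 1, 3, 4, 6, 7, ... divided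
   by the Vandermonde determinant has the same properties, so by interpolation
   the two agree up to a constant.  Specialising the 2N parameters to
   1, t, ..., t^(2N-1) turns both determinants into products, and t = 1, where
   all six weights coincide, gives the number of alternating sign matrices. *)
Require Import Defs.
From mathcomp Require Import all_boot all_order all_algebra all_fingroup all_field.
From mathcomp Require Import ring zify.

Set Implicit Arguments.
Unset Strict Implicit.
Unset Printing Implicit Defensive.

Import Order.TTheory GRing.Theory Num.Theory.
Local Open Scope ring_scope.

(** * The six-vertex partition function *)

Section SixVertex.
Variables (R : comNzRingType) (z : R).

(* The transfer operator of one row.  The bits record partial sums: [h] of the
   row to the left of the current entry, [u] of the column above it; the entry
   is 0 when both bits are kept and +1 or -1 when both are flipped. *)
Fixpoint row_op (x : R) (h : bool) (ys : seq R) (f : seq bool -> R)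
    (us : seq bool) {struct ys} : R :=
  match ys, us with
  | y :: ys', u :: us' =>
    (if h == u then z * y - x else z * x - y)
      * row_op x h ys' (fun vs => f (u :: vs)) us'
    + (if h == u then (if h then (z - 1) * x * y else z - 1) else 0)
      * row_op x (~~ h) ys' (fun vs => f (~~ u :: vs)) us'
  | _, _ => if h then f [::] else 0
  end.

(** The lower boundary: every column must total 1. Together with the all-[false] upper boundary of
    [Zpart] and the final row bit [true] required by [row_op], this is the domain wall boundary
    condition. *)
Definition all_ones (us : seq bool) : R := (all id us)%:R.

Fixpoint Zfrom (xs ys : seq R) : seq bool -> R :=
  if xs is x :: xs' then row_op x false ys (Zfrom xs' ys) else all_ones.

Definition Zpart (xs ys : seq R) : R := Zfrom xs ys (nseq (size ys) false).

Lemma eq_row_op x h ys f g us :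
    size us = size ys -> (forall vs, size vs = size ys -> f vs = g vs) ->
  row_op x h ys f us = row_op x h ys g us.
Proof.
elim: ys h f g us => [|y ys IH] h f g [|u us] //= => [_ -> //|[us_ys] fg].
by congr (_ * _ + _ * _); apply: IH => // vs vs_ys; apply: fg; rewrite /= vs_ys.
Qed.

Lemma row_op_lin x h ys f g a b us :
  row_op x h ys (fun vs => a * f vs + b * g vs) us =
  a * row_op x h ys f us + b * row_op x h ys g us.
Proof.
elim: ys h f g us => [|y ys IH] h f g [|u us] //=.
- by case: h => //; rewrite !mulr0 addr0.
- by case: h => //; rewrite !mulr0 addr0.
- by case: h => //; rewrite !mulr0 addr0.
by rewrite !IH; ring.
Qed.

Lemma row_op_scale x h ys f a us :
  row_op x h ys (fun vs => a * f vs) us = a * row_op x h ys f us.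
Proof.
elim: ys h f us => [|y ys IH] h f [|u us] /=; rewrite ?IH; try ring.
all: by case: h; rewrite ?mulr0.
Qed.

Definition swap_wt (y1 y2 : R) : R := z ^+ 2 * y2 - y1.

(** The R-matrix on the bits of two adjacent columns, a scalar on equal bits. Lists that are too
    short get the same scalar, so that [swap_op_nseq_false] needs no size condition. *)
Definition swap_op0 (y1 y2 : R) (f : seq bool -> R) (us : seq bool) : R :=
  if us is u1 :: u2 :: us' then
    if u1 == u2 then swap_wt y1 y2 * f us
    else (z ^+ 2 - 1) * (if u1 then y2 else y1) * f us
         + z * (y1 - y2) * f (u2 :: u1 :: us')
  else swap_wt y1 y2 * f us.

Fixpoint swap_op (p : nat) (y1 y2 : R) (f : seq bool -> R) : seq bool -> R :=
  if p is p'.+1 then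
    fun us => if us is u :: us'
              then swap_op p' y1 y2 (fun vs => f (u :: vs)) us'
              else swap_wt y1 y2 * f us
  else swap_op0 y1 y2 f.

Hypothesis z_root : z ^+ 2 + z + 1 = 0.

Lemma yang_baxter0 x h y1 y2 ys f u1 u2 us :
  row_op x h (y2 :: y1 :: ys) (swap_op0 y1 y2 f) (u1 :: u2 :: us) =
  swap_op0 y1 y2 (row_op x h (y1 :: y2 :: ys) f) (u1 :: u2 :: us).
Proof.
pose F v1 v2 := row_op x h ys (fun vs => f [:: v1, v2 & vs]) us.
have killed s : s * (z ^+ 2 + z + 1) = 0 by rewrite z_root mulr0.
(* The two sides agree identically except for the coefficient of [F u1 u2],
   where they differ by [k * (z ^+ 2 + z + 1)]. *)
pose k := (-1) ^+ (h == u1) * (z - 1) ^+ 2 * x * (y1 - y2) *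
          (if u1 then y2 else y1) * F u1 u2.
apply/eqP; rewrite -subr_eq0; apply/eqP.
rewrite -[RHS](killed (if u1 == u2 then 0 else k)) {}/k {}/F.
case: u1; case: u2; case: h => /=; rewrite ?row_op_lin ?row_op_scale /swap_wt;
  ring.
Qed.

Lemma swap_op_lin p y1 y2 f g a b us :
  swap_op p y1 y2 (fun vs => a * f vs + b * g vs) us =
  a * swap_op p y1 y2 f us + b * swap_op p y1 y2 g us.
Proof.
elim: p f g us => [|p IH] f g [|u us] //=; try ring.
by case: us => [|u' us] /=; [|case: ifP => _]; ring.
Qed.

Lemma yang_baxter x h y1 y2 ys1 ys2 f us :
    size us = size (ys1 ++ y1 :: y2 :: ys2) ->
  row_op x h (ys1 ++ y2 :: y1 :: ys2) (swap_op (size ys1) y1 y2 f) us =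
  swap_op (size ys1) y1 y2 (row_op x h (ys1 ++ y1 :: y2 :: ys2) f) us.
Proof.
elim: ys1 h f us => [|y ys1 IH] h f [|u us] //=.
  by case: us => [|u2 us] // _; apply: yang_baxter0.
by move=> [us_ys]; rewrite swap_op_lin !IH.
Qed.

Lemma swap_op_eq0 p y1 y2 f us :
  (forall vs, f vs = 0) -> swap_op p y1 y2 f us = 0.
Proof.
move=> f0; elim: p f f0 us => [|p IH] f f0 [|u us] /=; rewrite ?f0 ?mulr0 //.
- by case: us => [|u' us]; rewrite /= ?f0 ?mulr0 ?addr0 ?if_same.
- exact: IH.
Qed.

(** By [yang_baxter] the R-matrix passes through the rows one at a time, exchanging the two column
    parameters. Below the last row only all-[true] bits contribute, and there it is the scalar
    [swap_wt]. *)
Lemma swap_Zfrom xs y1 y2 ys1 ys2 us :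
    size us = size (ys1 ++ y1 :: y2 :: ys2) ->
  swap_op (size ys1) y1 y2 (Zfrom xs (ys1 ++ y1 :: y2 :: ys2)) us =
  swap_wt y1 y2 * Zfrom xs (ys1 ++ y2 :: y1 :: ys2) us.
Proof.
elim: xs us => [|x xs IH] us us_ys /=; last first.
  rewrite -yang_baxter // -row_op_scale; apply: eq_row_op => [|vs vs_ys].
    by rewrite us_ys !size_cat.
  by rewrite IH // vs_ys !size_cat.
elim: ys1 us us_ys => [|y ys1 IH] [|u us] //= => [|[us_ys]].
  by case: us => [|u' us] //= _; case: u; case: u'; rewrite /all_ones /=; ring.
case: u => /=; first exact: IH.
by rewrite swap_op_eq0 // mulr0.
Qed.

Lemma swap_op_nseq_false p m y1 y2 f :
  swap_op p y1 y2 f (nseq m false) = swap_wt y1 y2 * f (nseq m false).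
Proof.
by elim: p m f => [|p IH] [|m] f /=; rewrite ?IH; try case: m.
Qed.

(** The bits of the upper boundary are equal too, so the R-matrix acts by the same scalar at both
    ends. This scalar may vanish and is therefore kept on both sides. *)
Lemma Zpart_swap xs y1 y2 ys1 ys2 :
  swap_wt y1 y2 * Zpart xs (ys1 ++ y1 :: y2 :: ys2) =
  swap_wt y1 y2 * Zpart xs (ys1 ++ y2 :: y1 :: ys2).
Proof.
rewrite -(swap_op_nseq_false (size ys1)) swap_Zfrom ?size_nseq //.
by congr (_ * Zfrom _ _ _); rewrite !size_cat.
Qed.

(** Each row enters its first column with bit [false], and only equal bits can flip; a column bit
    [true] there never changes and the column is filled with 0. *)
Lemma Zfrom_frozen_column xs y ys us :
    size us = size ys ->
  Zfrom xs (y :: ys) (true :: us) =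
  \prod_(x <- xs) (z * x - y) * Zfrom xs ys us.
Proof.
elim: xs us => [|x xs IH] us us_ys /=; first by rewrite big_nil mul1r.
rewrite big_cons mul0r addr0 -mulrA; congr (_ * _).
by rewrite -row_op_scale; apply: eq_row_op.
Qed.

Lemma row_op_true_nseq x ys f :
  row_op x true ys f (nseq (size ys) false) =
  \prod_(y <- ys) (z * x - y) * f (nseq (size ys) false).
Proof.
elim: ys f => [|y ys IH] f /=; first by rewrite big_nil mul1r.
by rewrite IH big_cons; ring.
Qed.

(* At x = z y the weight of a corner entry 0 vanishes, so the corner entry is 1
   and its row and column are frozen. *)
Lemma Zpart_frozen xs y ys :
  Zpart (z * y :: xs) (y :: ys) =
  (z - 1) * \prod_(w <- ys) (z ^+ 2 * y - w) * \prod_(x <- xs) (z * x - y)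
  * Zpart xs ys.
Proof.
rewrite /Zpart /= subrr mul0r add0r row_op_true_nseq Zfrom_frozen_column ?size_nseq //.
by under eq_bigr do rewrite mulrA -expr2; ring.
Qed.

Lemma size_linear_mul (a b : R) (p : {poly R}) :
  (size ((a *: 'X + b%:P) * p)%R <= (size p).+1)%N.
Proof.
apply: (leq_trans (size_polyMleq _ _)).
suff: (size (a *: 'X + b%:P)%R <= 2)%N by lia.
rewrite (leq_trans (size_polyD _ _)) // geq_max.
rewrite (leq_trans (size_scale_leq _ _)) ?size_polyX //.
exact: leq_trans (size_polyC_leq1 _) _.
Qed.

(** Under all-[false] column bits the only possible nonzero entry is 1, whose weight [z - 1] is free
    of x, while the entries 0 have weights linear in x. A row entered with [false] must contain a 1,
    which saves one degree. *)
Lemma row_op_poly (f : seq bool -> R) (ys : seq R) (h : bool) :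
  exists2 p : {poly R}, (size p <= size ys + h)%N &
    forall x, row_op x h ys f (nseq (size ys) false) = p.[x].
Proof.
elim: ys f h => [|y ys IH] f h /=.
  exists (if h then (f [::])%:P else 0); last by case: h => x; rewrite hornerE.
  by case: h; rewrite ?size_poly0 ?size_polyC_leq1.
case: h => /=; last first.
  have [p szp pE] := IH (fun vs => f (false :: vs)) false.
  have [q szq qE] := IH (fun vs => f (true :: vs)) true.
  exists (((-1) *: 'X + (z * y)%:P) * p + (z - 1) *: q); last first.
    by move=> x; rewrite pE qE !hornerE; ring.
  rewrite (leq_trans (size_polyD _ _)) // geq_max.
  apply/andP; split; first by apply: leq_trans (size_linear_mul _ _ _) _.
  by apply: leq_trans (size_scale_leq _ _) _; rewrite addn0 -addn1.
have [p szp pE] := IH (fun vs => f (false :: vs)) true.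
exists ((z *: 'X + (- y)%:P) * p); last first.
  by move=> x; rewrite pE !hornerE; ring.
by rewrite (leq_trans (size_linear_mul _ _ _)) //; lia.
Qed.

End SixVertex.

(** * Alternants *)

Section AltDet.
Variable R : comNzRingType.
Implicit Types (e : nat -> nat) (v w : seq R).

Definition alt_det n e v : R := \det (\matrix_(i < n, j < n) v`_i ^+ e j).

(** The sign depends only on the permutation of the rows, so one [b] serves both exponent sequences
    and cancels between the two alternants. *)
Lemma alt_det_perm n v w : size w = n -> perm_eq v w ->
  exists b : bool, forall e, alt_det n e v = (-1) ^+ b * alt_det n e w.
Proof.
move=> /eqP wn; rewrite -[w]/(val (Tuple wn)) => /tuple_permP[s ->].
exists s => e; rewrite /alt_det -det_perm -det_mulmx -row_permE; congr (\det _).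
by apply/matrixP=> i j; rewrite !mxE -tnth_nth tnth_mktuple (tnth_nth 0).
Qed.

Lemma alt_det_dup n e x w : size w = n -> x \in w -> alt_det n.+1 e (x :: w) = 0.
Proof.
move=> wn xw; have ltn : (index x w < n)%N by rewrite -wn index_mem.
apply: (@determinant_alternate _ _ _ ord0 (lift ord0 (Ordinal ltn))) => // j.
by rewrite !mxE /= nth_index.
Qed.

Lemma alt_det_poly n e w : (forall j, (j <= n)%N -> (e j <= e n)%N) ->
  exists2 p : {poly R}, (size p <= (e n).+1)%N &
    forall x, alt_det n.+1 e (x :: w) = p.[x].
Proof.
move=> e_le.
pose A x := \matrix_(i < n.+1, j < n.+1) (x :: w)`_i ^+ e j.
(* The cofactors along the first row do not involve x and can be taken from [A 0]. *)
exists (\sum_(j < n.+1) cofactor (A 0) ord0 j *: 'X^(e j)).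
  apply: (leq_trans (size_sum _ _ _)); apply/bigmax_leqP => j _.
  rewrite (leq_trans (size_scale_leq _ _)) // size_polyXn ltnS e_le //.
  by rewrite -ltnS.
move=> x; rewrite horner_sum /alt_det (expand_det_row _ ord0).
apply: eq_bigr => j _; rewrite hornerZ hornerXn mxE [RHS]mulrC; congr (_ * _).
rewrite /cofactor; congr (_ * \det _); apply/matrixP => i k.
by rewrite !mxE.
Qed.

(* Subtracting [c] times the column [m] places to the left clears the first
   [m] rows of all but the first [m] columns. *)
Lemma alt_det_cat m n e d c v w :
    (0 < m)%N -> size v = m -> size w = n ->
    (forall j, e (m + j)%N = (e j + d)%N) -> {in v, forall x, x ^+ d = c} ->
  alt_det (m + n) e (v ++ w) =
  alt_det m e v * \prod_(x <- w) (x ^+ d - c) * alt_det n e w.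
Proof.
move=> m_gt0 vm wn eS vc.
pose A := \matrix_(i < m + n, j < m + n) (v ++ w)`_i ^+ e j.
pose U : 'M[R]_(m + n) := \matrix_(k, j) ((k == j)%:R - c * ((k + m)%N == j)%:R).
have detU : \det U = 1.
  rewrite -det_tr det_trig; last first.
    apply/is_trig_mxP => i j lt_ij; rewrite !mxE.
    have -> : (j == i) = false by apply: contraTF lt_ij => /eqP ->; rewrite ltnn.
    have -> : (j + m == i)%N = false by lia.
    by rewrite !mulr0n mulr0 subr0.
  rewrite big1 // => i _; rewrite !mxE eqxx.
  have -> : (i + m == i)%N = false by lia.
    by rewrite mulr0n mulr0 subr0.
have AU i j : (A *m U) i j =
    (v ++ w)`_i ^+ e j - (if (m <= j)%N then c * (v ++ w)`_i ^+ e (j - m)%N else 0).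
  rewrite mxE.
  under eq_bigr => k _ do rewrite !mxE mulrBr.
  rewrite sumrB; congr (_ - _).
    rewrite (bigD1 j) //= eqxx mulr1n mulr1 big1 ?addr0 // => k /negbTE ->.
    by rewrite mulr0n mulr0.
  case: leqP => mj; last first.
    rewrite big1 // => k _; have -> : (k + m == j)%N = false by lia.
    by rewrite mulr0n !mulr0.
  have ltj : (j - m < m + n)%N by have := ltn_ord j; lia.
  rewrite (bigD1 (Ordinal ltj)) //= subnK // eqxx mulr1n mulr1 big1 ?addr0 1?mulrC //.
  move=> k neq; have -> : (k + m == j)%N = false; last by rewrite mulr0n !mulr0.
  by apply: contraNF neq => /eqP kmj; apply/eqP/val_inj; rewrite /= -kmj addnK.
rewrite /alt_det -/A -[LHS]mulr1 -[X in _ * X = _]detU -det_mulmx.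
move: (A *m U) AU => B AU; rewrite -[B]submxK.
have -> : ursubmx B = 0.
  apply/matrixP => i j; rewrite !mxE AU /= leq_addr eS addKn nth_cat vm ltn_ord.
  by rewrite exprD vc ?mem_nth ?vm // [_ * c]mulrC subrr.
rewrite det_lblock -mulrA; congr (_ * _).
  congr (\det _); apply/matrixP => i j.
  by rewrite !mxE AU /= leqNgt ltn_ord subr0 nth_cat vm ltn_ord.
(* In a row of [w] the column operation turns [x ^+ (e j + d)] into [(x ^+ d - c) * x ^+ e j], so
   each row carries a common factor. *)
have -> : \prod_(x <- w) (x ^+ d - c) = \det (diag_mx (\row_(i < n) (w`_i ^+ d - c))).
  rewrite det_diag (big_nth 0) wn big_mkord.
  by apply: eq_bigr => i _; rewrite mxE.
rewrite -det_mulmx; congr (\det _); apply/matrixP => i j.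
rewrite mul_diag_mx !mxE AU /= leq_addr eS addKn nth_cat vm.
rewrite ltnNge leq_addr /= addKn exprD; ring.
Qed.

(** Since [(t ^+ i) ^+ e j] equals [(t ^+ e j) ^+ i], the alternant is a Vandermonde determinant in
    the [t ^+ e j]. *)
Lemma alt_det_geom n e t :
  alt_det n e (mkseq (fun i => t ^+ i) n) =
  \prod_(i < n) \prod_(j < n | (i < j)%N) (t ^+ e j - t ^+ e i).
Proof.
transitivity (\det (Vandermonde n (\row_(j < n) t ^+ e j))).
  congr (\det _); apply/matrixP => i j.
  by rewrite !mxE nth_mkseq // -!exprM mulnC.
rewrite det_Vandermonde; apply: eq_bigr => i _; apply: eq_bigr => j _.
by rewrite !mxE.
Qed.

End AltDet.

(** * The partition function as a ratio of alternants *)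

Lemma root_cube (R : comNzRingType) (z : R) : z ^+ 2 + z + 1 = 0 -> z ^+ 3 = 1.
Proof.
move=> z_root; apply/eqP; rewrite -subr_eq0 -(mulr0 (z - 1)) -z_root.
by apply/eqP; ring.
Qed.

(* The exponents 0, 1, 3, 4, 6, 7, ... *)
Definition schur_exp (j : nat) : nat := (j + j./2)%N.

Lemma schur_expD2 j : schur_exp (2 + j) = (schur_exp j + 3)%N.
Proof. by rewrite /schur_exp /= ; lia. Qed.

Lemma leq_schur_exp i j : (i <= j)%N -> (schur_exp i <= schur_exp j)%N.
Proof. by move=> le_ij; rewrite leq_add ?half_leq. Qed.

Section Evaluation.
Variables (K : fieldType) (z : K).
Hypothesis z_root : z ^+ 2 + z + 1 = 0.

Lemma big_mulrl_seq (c : K) (f : K -> K) (w : seq K) :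
  \prod_(x <- w) (c * f x) = c ^+ size w * \prod_(x <- w) f x.
Proof. by rewrite big_split big_const_seq count_predT iter_mulr_1. Qed.

(** Each frozen corner contributes [z - 1]; matching its linear weights with the alternants
    contributes -1 for each remaining column parameter and [z] for each remaining row parameter. *)
Fixpoint Zconst (n : nat) : K :=
  if n is n'.+1 then (z - 1) * (- z) ^+ n' * Zconst n' else 1.

(** This makes the swap weights nonzero and the interpolation nodes distinct. *)
Definition generic (xs ys : seq K) := uniq (ys ++ [seq z * y | y <- ys] ++ xs).

(** As [z ^+ 3 = 1], the swap weight [z ^+ 2 * y - w] vanishes only if [z * w = y], which
    distinctness excludes; so [y] can be moved to the front by cancelling one weight per swap. *)
Lemma Zpart_rot xs ys1 y ys2 :
    uniq ((ys1 ++ y :: ys2) ++ [seq z * w | w <- ys1 ++ y :: ys2]) ->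
  Zpart z xs (ys1 ++ y :: ys2) = Zpart z xs (y :: ys1 ++ ys2).
Proof.
elim/last_ind: ys1 ys2 => [//|ys1 w IH] ys2; rewrite !cat_rcons => u.
have wt0 : swap_wt z w y != 0.
  apply: contraTneq u => /eqP; rewrite subr_eq0 => /eqP wE.
  have zw : z * w = y.
    by rewrite -wE mulrA -exprS (root_cube z_root) mul1r.
  rewrite cat_uniq !negb_and negbK; apply/orP; right; apply/orP; left.
  apply/hasP; exists y; last by rewrite mem_cat !inE eqxx !orbT.
  by rewrite -zw map_f // mem_cat !inE eqxx orbT.
apply: (mulfI wt0); rewrite Zpart_swap // IH //.
rewrite -(perm_uniq (s1 := (ys1 ++ w :: y :: ys2) ++ [seq z * w | w <- ys1 ++ w :: y :: ys2])) //.
have perm : perm_eq (ys1 ++ w :: y :: ys2) (ys1 ++ y :: w :: ys2).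
  by rewrite perm_cat2l; apply/permPl/(perm_catCA [:: w] [:: y]).
by rewrite perm_cat ?perm_map.
Qed.

Lemma generic_rem xs ys1 y ys2 x :
  generic (x :: xs) (ys1 ++ y :: ys2) -> generic xs (ys1 ++ ys2).
Proof.
apply: subseq_uniq; have sub : subseq (ys1 ++ ys2) (ys1 ++ y :: ys2).
  by rewrite cat_subseq // subseq_cons.
by rewrite !cat_subseq ?map_subseq // subseq_cons.
Qed.

Lemma Zpart_alt_det_step n xs ys1 y ys2 :
    size xs = n -> size (ys1 ++ ys2) = n ->
    uniq ((ys1 ++ y :: ys2) ++ [seq z * w | w <- ys1 ++ y :: ys2]) ->
    Zpart z xs (ys1 ++ ys2) * alt_det (n + n) id ((ys1 ++ ys2) ++ xs) =
    Zconst n * alt_det (n + n) schur_exp ((ys1 ++ ys2) ++ xs) ->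
  Zpart z (z * y :: xs) (ys1 ++ y :: ys2) *
    alt_det (n + n).+2 id (z * y :: xs ++ ys1 ++ y :: ys2) =
  Zconst n.+1 * alt_det (n + n).+2 schur_exp (z * y :: xs ++ ys1 ++ y :: ys2).
Proof.
move=> szx szy u IH; rewrite Zpart_rot // Zpart_frozen.
set w := ys1 ++ ys2 in szy IH *.
have szw : size (w ++ xs) = (n + n)%N by rewrite size_cat szx szy.
have perm : perm_eq (z * y :: xs ++ ys1 ++ y :: ys2) ([:: y; z * y] ++ (w ++ xs)).
  rewrite perm_sym -[_ ++ (w ++ xs)]/([:: y] ++ [:: z * y] ++ (w ++ xs)) perm_catCA /= perm_cons.
  rewrite -cat_cons perm_catC perm_cat2l /w.
  by rewrite -[y :: _]/([:: y] ++ _ ++ _) -[y :: ys2]/([:: y] ++ ys2) perm_catCA.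
clearbody w; have szv : size ([:: y; z * y] ++ (w ++ xs)) = (n + n).+2 by rewrite size_cat szw.
have [b bE] := alt_det_perm szv perm.
rewrite !bE ![_ * (_ ^+ b * _)]mulrCA; congr (_ * _).
have -> : alt_det (n + n).+2 id ([:: y; z * y] ++ (w ++ xs)) =
    (z * y - y) * \prod_(x <- w ++ xs) ((x - y) * (x - z * y)) * alt_det (n + n) id (w ++ xs).
  rewrite (@alt_det_cat _ 1 _ _ 1 y [:: y] (z * y :: w ++ xs)) //=; last 3 first.
  - by rewrite szw.
  - by move=> j; rewrite add1n addn1.
  - by move=> x; rewrite inE => /eqP ->.
  rewrite (@alt_det_cat _ 1 _ _ 1 (z * y) [:: z * y] (w ++ xs)) //=; last 2 first.
  - by move=> j; rewrite add1n addn1.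
  - by move=> x; rewrite inE => /eqP ->.
  rewrite /alt_det !det_mx11 !mxE !expr0 big_cons big_split /= !mul1r; ring.
(* Two places to the right the exponents grow by 3, and [y] and [z * y] have the same cube, so both
   rows split off together. *)
rewrite (@alt_det_cat _ 2 _ schur_exp 3 (y ^+ 3)) //; last 2 first.
- exact: schur_expD2.
- move=> x; rewrite !inE => /orP[] /eqP -> //.
  transitivity (y ^+ 3 + (z - 1) * (z ^+ 2 + z + 1) * y ^+ 3); first by ring.
  by rewrite z_root; ring.
have -> : alt_det 2 schur_exp [:: y; z * y] = z * y - y.
  rewrite /alt_det (expand_det_row _ ord0) !big_ord_recl big_ord0 /cofactor !det_mx11 !mxE /=.
  rewrite /schur_exp /=; ring.
have z_cube := root_cube z_root.
have cubic x : (z ^+ 2 * y - x) * ((x - y) * (x - z * y)) = -1 * (x ^+ 3 - y ^+ 3).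
  transitivity (-1 * (x ^+ 3 - y ^+ 3) + (z ^+ 2 + z + 1) *
    (y * x ^+ 2 - z * y ^+ 2 * x + (z - 1) * y ^+ 3)); first by ring.
  by rewrite z_root; ring.
have cubic' x : (z * x - y) * ((x - y) * (x - z * y)) = z * (x ^+ 3 - y ^+ 3).
  transitivity (- z * ((z ^+ 2 * y - x) * ((x - y) * (x - z * y))) +
    (z ^+ 3 - 1) * y * ((x - y) * (x - z * y))); first by ring.
  by rewrite cubic z_cube; ring.
transitivity ((z - 1) * (\prod_(x <- w) ((z ^+ 2 * y - x) * ((x - y) * (x - z * y))) *
    \prod_(x <- xs) ((z * x - y) * ((x - y) * (x - z * y)))) * (z * y - y) *
    (Zpart z xs w * alt_det (n + n) id (w ++ xs))).
  by rewrite big_cat !big_split /=; ring.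
rewrite IH.
rewrite (eq_bigr _ (fun x _ => cubic x)) (eq_bigr _ (fun x _ => cubic' x)).
rewrite !big_mulrl_seq szx szy big_cat /= [(- z) ^+ n]exprNn; ring.
Qed.

Theorem Zpart_alt_det n xs ys : size xs = n -> size ys = n -> generic xs ys ->
  Zpart z xs ys * alt_det (n + n) id (ys ++ xs) =
  Zconst n * alt_det (n + n) schur_exp (ys ++ xs).
Proof.
elim: n xs ys => [|n IH] [|x xs] ys //=.
  move=> _ /size0nil -> _; rewrite /Zpart /= /all_ones /= /alt_det !det_mx00.
  by rewrite mulr1.
move=> [szx] szy gen.
have szw : size (xs ++ ys) = (n + n).+1 by rewrite size_cat szx szy addnS.
have szw' : size (x :: xs ++ ys) = (n.+1 + n.+1)%N by rewrite /= szw addnS.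
have perm : perm_eq (ys ++ x :: xs) (x :: xs ++ ys).
  by rewrite perm_catC.
have [b bE] := alt_det_perm szw' perm.
rewrite !bE ![_ * (_ ^+ b * _)]mulrCA; congr (_ * _).
rewrite addnS -[(n.+1 + n).+1]/(n + n).+2.
have [pZ szZ pZE] := row_op_poly z (Zfrom z xs ys) ys false.
have [pV szV pVE] := @alt_det_poly _ (n + n).+1 id (xs ++ ys) (fun j => id).
have [pD szD pDE] := @alt_det_poly _ (n + n).+1 _ (xs ++ ys) (fun j => @leq_schur_exp j _).
pose P := pZ * pV - Zconst n.+1 *: pD.
suff P0 : P = 0.
  have := horner0 x; rewrite -P0 !hornerE -pZE -pVE -pDE => /eqP.
  by rewrite subr_eq0 => /eqP.
(* These are [3n + 2] nodes, while both terms of [P] have degree at most [3n + 1]: n plus [2n + 1]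
   for the first, and [schur_exp (2n + 1)] for the second. *)
pose rs := (xs ++ ys) ++ [seq z * y | y <- ys].
have uniq_rs : uniq rs.
  move: gen; rewrite /generic -(perm_uniq (s1 := (x :: xs ++ ys) ++ [seq z * y | y <- ys])).
    by case/andP.
  by rewrite -cat_cons -catA perm_catC -catA.
apply: contraTeq isT => /max_poly_roots/(_ _ uniq_rs) H.
suff /H : all (root P) rs.
  rewrite /rs 2!size_cat size_map szx szy ltnNge => /negP[].
  apply: (leq_trans (size_polyD _ _)); rewrite geq_max size_polyN; apply/andP; split.
    rewrite (leq_trans (size_polyMleq _ _)) //; move: szZ szV; rewrite addn0 szy /=.
    by move: (size pZ) (size pV) => a c; lia.
  apply: (leq_trans (size_scale_leq _ _)); apply: leq_trans szD _.
  by rewrite /schur_exp; lia.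
rewrite all_cat; apply/andP; split; apply/allP => u.
  by move=> uw; rewrite /root !hornerE -pVE -pDE !alt_det_dup // !mulr0 subrr.
case/mapP => y ys_y ->{u}.
rewrite /root !hornerE subr_eq0 -pZE -pVE -pDE; apply/eqP.
rewrite -[row_op _ _ _ _ _ _]/(Zpart z (z * y :: xs) ys).
clear H uniq_rs rs P pZ szZ pZE pV szV pVE pD szD pDE szw szw' bE perm.
case/splitPr: ys_y gen szy => ys1 ys2 gen szy.
have szy' : size (ys1 ++ ys2) = n.
  by move: szy; rewrite !size_cat /= addnS => -[].
apply: Zpart_alt_det_step => //.
  by move: gen; rewrite /generic catA cat_uniq => /and3P[].
by apply: IH => //; apply: generic_rem gen.
Qed.

End Evaluation.

(** * The homogeneous limit *)

Section Morphism.
Variables (R S : comNzRingType) (phi : {rmorphism R -> S}).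

Lemma rmorph_row_op z x h ys f us :
  phi (row_op z x h ys f us) =
  row_op (phi z) (phi x) h (map phi ys) (phi \o f) us.
Proof.
elim: ys h f us => [|y ys IH] h f [|u us] /=; try by case: h; rewrite ?rmorph0.
rewrite rmorphD !rmorphM !IH; congr (_ * _ + _ * _).
  by case: ifP => _; rewrite rmorphB rmorphM.
by do 2?case: ifP => _; rewrite ?rmorph0 ?rmorphM ?rmorphB ?rmorph1.
Qed.

Lemma rmorph_Zpart z xs ys :
  phi (Zpart z xs ys) = Zpart (phi z) (map phi xs) (map phi ys).
Proof.
rewrite /Zpart size_map; move: (nseq _ _) (size_nseq (size ys) false).
elim: xs => [|x xs IH] us us_ys /=; first by rewrite rmorph_nat.
rewrite rmorph_row_op; apply: eq_row_op; rewrite ?size_map // => vs vs_ys.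
Qed.

End Morphism.

(** For nondecreasing [e], the value at [t = 1] of the product in [alt_det_geom] once a factor
    [t - 1] is removed for each pair. *)
Definition diff_prod (e : nat -> nat) (m : nat) : nat :=
  \prod_(i < m) \prod_(j < m | (i < j)%N) (e j - e i)%N.

Section PrincipalSpecialization.
Variables (K : numFieldType) (z : K).
Hypothesis z_root : z ^+ 2 + z + 1 = 0.

Lemma mkseq_cat (T : Type) (f : nat -> T) m n :
  mkseq f (m + n) = mkseq f m ++ mkseq (fun i => f (m + i)%N) n.
Proof.
rewrite /mkseq iotaD map_cat; congr (_ ++ _).
by rewrite addnC iotaDl -map_comp.
Qed.

(** Cubing removes [z]: if a power of t equals [z] times another, the exponents agree, and then
    [z = 1], impossible in characteristic 0. *)
Lemma generic_geom (n t : nat) : (1 < t)%N ->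
  generic z (mkseq (fun i => t%:R ^+ (n + i)) n) (mkseq (fun i => t%:R ^+ i) n).
Proof.
move=> t_gt1; rewrite /generic uniq_catCA -mkseq_cat.
have z_cube := root_cube z_root.
have z0 : z != 0.
  by apply: contra_eqN z_cube => /eqP ->; rewrite expr0n eq_sym oner_eq0.
have z1 : z != 1.
  by apply: contra_eqN z_root => /eqP ->; rewrite (_ : _ + 1 = 3%:R) ?pnatr_eq0 //; ring.
have t_inj : injective (fun i => t%:R ^+ i : K).
  by move=> i j /eqP; rewrite -!natrX eqr_nat => /eqP /(expnI t_gt1).
rewrite cat_uniq map_inj_uniq ?mkseq_uniq //; last exact: mulfI.
rewrite andbT andTb; apply/hasPn => _ /mapP[j _ ->].
apply/negP => /mapP[_ /mapP[i _ ->] /esym E].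
have ij : i = j.
  have : (t%:R ^+ i : K) ^+ 3 = (t%:R ^+ j) ^+ 3 by rewrite -E exprMn z_cube mul1r.
  by rewrite -!exprM => /t_inj; lia.
move: E; rewrite ij -[RHS]mul1r => /(mulIf _) zE.
by case/eqP: z1; apply: zE; rewrite expf_neq0 // pnatr_eq0; lia.
Qed.

Lemma poly_eq_nat (p q : {poly K}) :
  (forall t, (1 < t)%N -> p.[t%:R] = q.[t%:R]) -> p = q.
Proof.
move=> pq; apply/eqP; rewrite -subr_eq0; apply: contraTT isT => pq0.
have := @max_poly_roots _ _ (mkseq (fun i => (i.+2)%:R : K) (size (p - q))) pq0.
rewrite size_mkseq ltnn; apply.
  by apply/allP => _ /mapP[i _ ->]; rewrite /root !hornerE pq // subrr.
by rewrite mkseq_uniq // => i j /eqP; rewrite eqr_nat => /eqP[].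
Qed.

(** For [a <= b], ['X^b - 'X^a] is ['X - 1] times ['X^a] times a geometric sum of [b - a] terms. *)
Lemma prod_Xn_sub e m : {homo e : i j / (i <= j)%N} -> exists2 g : {poly K},
  \prod_(i < m) \prod_(j < m | (i < j)%N) ('X^(e j) - 'X^(e i)) =
  (\prod_(i < m) \prod_(j < m | (i < j)%N) ('X - 1)) * g & g.[1] = (diff_prod e m)%:R.
Proof.
move=> e_mono.
exists (\prod_(i < m) \prod_(j < m | (i < j)%N) ('X^(e i) * \sum_(k < e j - e i) 'X^k)).
  rewrite -big_split; apply: eq_bigr => i _; rewrite -big_split; apply: eq_bigr => j lt_ij.
  by rewrite /= mulrCA -subrX1 mulrBr mulr1 -exprD subnKC // e_mono // ltnW.
rewrite /diff_prod horner_prod natr_prod; apply: eq_bigr => i _.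
rewrite horner_prod natr_prod; apply: eq_bigr => j _.
rewrite hornerM hornerXn expr1n mul1r horner_sum.
under eq_bigr do rewrite hornerXn expr1n.
by rewrite sumr_const card_ord.
Qed.

(** At [t = 1] the alternants may vanish, so the identity is first lifted from the integers [t > 1]
    to polynomials in t, where the common power [D] of ['X - 1] cancels. *)
Lemma Zpart_ones n :
  Zpart z (nseq n 1) (nseq n 1) * (diff_prod id (n + n))%:R =
  Zconst z n * (diff_prod schur_exp (n + n))%:R.
Proof.
pose Q := Zpart z%:P (mkseq (fun i => 'X^(n + i)) n) (mkseq (fun i => 'X^i) n).
have QE t : Q.[t] = Zpart z (mkseq (fun i => t ^+ (n + i)) n) (mkseq (fun i => t ^+ i) n).
  rewrite -/(horner_eval t Q) rmorph_Zpart -!map_comp /= /horner_eval hornerC.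
  by congr Zpart; apply: eq_map => i /=; rewrite hornerXn.
have Q1 : Q.[1] = Zpart z (nseq n 1) (nseq n 1).
  rewrite QE; congr Zpart; apply: (@eq_from_nth _ 0); rewrite ?size_mkseq ?size_nseq // => i lti.
    by rewrite nth_mkseq // nth_nseq lti expr1n.
  by rewrite nth_mkseq // nth_nseq lti expr1n.
have [g gE g1] := @prod_Xn_sub id (n + n) (fun i j => id).
have [s sE s1] := @prod_Xn_sub schur_exp (n + n) leq_schur_exp.
pose D : {poly K} := \prod_(i < n + n) \prod_(j < n + n | (i < j)%N) ('X - 1).
have D0 : D != 0.
  by apply/prodf_neq0 => i _; apply/prodf_neq0 => j _; rewrite polyXsubC_eq0.
have : Q * (D * g) = Zconst z n *: (D * s).
  rewrite /D -gE -sE; apply: poly_eq_nat => t t_gt1.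
  have := @Zpart_alt_det _ _ z_root n _ _ (size_mkseq _ _) (size_mkseq _ _) (generic_geom n t_gt1).
  rewrite -mkseq_cat !alt_det_geom hornerM hornerZ QE.
  move=> E; rewrite !horner_prod; under eq_bigr => i _.
    rewrite horner_prod; under eq_bigr => j _ do rewrite hornerD hornerN !hornerXn.
    over.
  rewrite E; congr (_ * _).
  apply: eq_bigr => i _; rewrite horner_prod; apply: eq_bigr => j _.
  by rewrite hornerD hornerN !hornerXn.
rewrite mulrCA scalerAr => /(mulfI D0) /(congr1 (horner^~ 1)).
by rewrite hornerM hornerZ Q1 g1 s1.
Qed.

End PrincipalSpecialization.

(** * Alternating sign matrices as six-vertex states *)

Definition bit (b : bool) : int := (b : nat)%:Z.

Fixpoint line_ok (h : bool) (s : seq int) : bool :=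
  if s is a :: s' then
    (bit h + a \in [:: 0; 1]) && line_ok (bit h + a == 1) s'
  else h.

(** Reads the matrix row by row while carrying the column partial sums [us], in parallel with the
    recursion of [Zfrom]. *)
Fixpoint asm_from (us : seq bool) (M : seq (seq int)) : bool :=
  if M is r :: M' then
    [&& line_ok false r, all2 (fun u a => bit u + a \in [:: 0; 1]) us r
      & asm_from [seq bit p.1 + p.2 == 1 | p <- zip us r] M']
  else all id us.

Lemma big_cons_tuple (R : nmodType) (T : finType) n (F : seq T -> R) :
  \sum_(s : n.+1.-tuple T) F s = \sum_(a : T) \sum_(s : n.-tuple T) F (a :: s).
Proof.
rewrite pair_big /=.
rewrite (reindex (fun p : T * n.-tuple T => [tuple of p.1 :: p.2])) //=.
exists (fun s : n.+1.-tuple T => (thead s, [tuple of behead s])) => [[a s] _|s _] /=.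
  by congr (_, _); apply: val_inj.
by rewrite -tuple_eta.
Qed.

Lemma sum_sign_entry (R : nmodType) (F : int -> R) :
  \sum_(a : sign_entry) F (val a) = F (-1) + F 0 + F 1.
Proof.
rewrite -(big_map val xpredT F).
rewrite (perm_big [:: -1; 0; 1 : int]) /=.
  by rewrite !big_cons big_nil /= addr0 addrA.
apply: uniq_perm; rewrite ?(map_inj_uniq val_inj) ?index_enum_uniq // => a.
apply/mapP/idP => [[b _ ->]|a_in]; first exact: valP.
by exists (SeqSub a_in); rewrite ?mem_index_enum.
Qed.

Lemma big_sign_tuple0 (R : nmodType) (F : seq int -> R) :
  \sum_(s : 0.-tuple sign_entry) F (map val s) = F [::].
Proof.
rewrite (big_pred1 [tuple]) // => s; apply/esym/eqP; exact: tuple0.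
Qed.

Lemma big_sign_tuple (R : nmodType) n (F : seq int -> R) :
  \sum_(s : n.+1.-tuple sign_entry) F (map val s) =
  \sum_(s : n.-tuple sign_entry) F (-1 :: map val s) +
  \sum_(s : n.-tuple sign_entry) F (0 :: map val s) +
  \sum_(s : n.-tuple sign_entry) F (1 :: map val s).
Proof.
rewrite (big_cons_tuple n (fun s : seq sign_entry => F (map val s))).
exact: (sum_sign_entry (fun b => \sum_(s : n.-tuple sign_entry) F (b :: map val s))).
Qed.

Definition step_ok (us : seq bool) (r : seq int) : bool :=
  all2 (fun u a => bit u + a \in [:: 0; 1]) us r.

Definition step (us : seq bool) (r : seq int) : seq bool :=
  [seq bit p.1 + p.2 == 1 | p <- zip us r].

Section Count.
Variables (K : comNzRingType) (z : K).

(** With all parameters 1, each allowed entry has weight [z - 1], so the transfer operator merely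
    counts admissible rows. *)
Lemma row_op_ones N h f us : size us = N ->
  row_op z 1 h (nseq N 1) f us = (z - 1) ^+ N *
    \sum_(r : N.-tuple sign_entry)
      (line_ok h (map val r) && step_ok us (map val r))%:R * f (step us (map val r)).
Proof.
elim: N h f us => [|N IH] h f [|u us] //=.
  move=> _; rewrite mul1r.
  rewrite (big_sign_tuple0 (fun r => (line_ok h r && step_ok [::] r)%:R * f (step [::] r))) /=.
  by case: h; rewrite ?mul1r ?mul0r.
move=> [us_N].
rewrite (@big_sign_tuple K N (fun r =>
  (line_ok h r && step_ok (u :: us) r)%:R * f (step (u :: us) r))).
rewrite !IH // !mulr1 /step_ok /=.
(* [X], [Y] and [W] collect the rows that begin with -1, 0 and 1. *)
set X := (X in _ = _ * (X + _ + _)); set Y := (X in _ = _ * (_ + X + _)).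
set W := (X in _ = _ * (_ + X)).
pose S h' (v : bool) := \sum_(r : N.-tuple sign_entry) (line_ok h' (map val r) &&
  step_ok us (map val r))%:R * f (v :: step us (map val r)).
have YE : Y = S h u.
  apply: eq_bigr => r _; rewrite /= !addr0.
  by case: (h); case: (u).
have XE : X = if h && u then S (~~ h) (~~ u) else 0.
  rewrite /X; case: (h); case: (u) => /=; first (by []);
  by rewrite big1 // => r _; rewrite ?andbF mul0r.
have WE : W = if h || u then 0 else S (~~ h) (~~ u).
  rewrite /W; case: (h); case: (u) => /=; try (by []);
  by rewrite big1 // => r _; rewrite ?andbF mul0r.
rewrite XE YE WE /S exprS.
by case: (h); case: (u) => /=; ring.
Qed.

Lemma Zfrom_ones m N us : size us = N ->
  Zfrom z (nseq m 1) (nseq N 1) us = (z - 1) ^+ (m * N) *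
    \sum_(M : m.-tuple (N.-tuple sign_entry))
      (asm_from us [seq map val (val r) | r : N.-tuple sign_entry <- M])%:R.
Proof.
elim: m us => [|m IH] us us_N /=.
  rewrite (big_pred1 [tuple]) ?mul1r // => s; apply/esym/eqP; exact: tuple0.
rewrite row_op_ones // mulSn exprD -mulrA; congr (_ * _).
rewrite (big_cons_tuple m (fun M : seq (N.-tuple sign_entry) =>
  (asm_from us [seq map val (val r) | r <- M])%:R)) big_distrr /=.
apply: eq_bigr => r _; rewrite IH; last first.
  by rewrite size_map size_zip size_map size_tuple us_N minnn.
rewrite mulrCA; congr (_ * _); rewrite big_distrr /=.
by apply: eq_bigr => M _; rewrite -natrM mulnb -andbA.
Qed.

End Count.

Lemma bit_in b : bit b \in [:: 0; 1].
Proof. by case: b. Qed.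

Lemma bit_eq1 (x : int) : x \in [:: 0; 1] -> bit (x == 1) = x.
Proof. by rewrite !inE => /orP[] /eqP ->. Qed.

Lemma line_okP h s :
  reflect ((forall m, bit h + \sum_(a <- take m s) a \in [:: 0; 1]) /\
           bit h + \sum_(a <- s) a = 1)
          (line_ok h s).
Proof.
elim: s h => [|a s IH] h /=.
  apply: (iffP idP) => [->|[_]]; last by rewrite big_nil addr0; case: h.
  by split=> [m|]; rewrite big_nil.
apply: (iffP andP) => [[ha /IH[]]|[part tot]].
  rewrite bit_eq1 // => part tot; split=> [[|m]|]; last by rewrite big_cons addrA.
    by rewrite big_nil addr0 bit_in.
  by rewrite big_cons addrA.
have ha : bit h + a \in [:: 0; 1] by have := part 1%N; rewrite /= take0 big_seq1.
split=> //; apply/IH; rewrite bit_eq1 //; split=> [m|].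
  by have := part m.+1; rewrite /= big_cons addrA.
by rewrite -tot big_cons addrA.
Qed.

(** As the total is 1, each partial sum of the reversed line is 1 minus a partial sum of the
    line. *)
Lemma line_ok_rev s : line_ok false (rev s) = line_ok false s.
Proof.
suff impl r : line_ok false r -> line_ok false (rev r).
  by apply/idP/idP => [/impl|/impl]; rewrite ?revK.
move=> /line_okP[part tot]; apply/line_okP; rewrite !add0r in tot *.
have -> : \sum_(a <- rev r) a = \sum_(a <- r) a.
  by apply: perm_big; rewrite perm_rev.
split=> // m; rewrite add0r take_rev.
have -> : \sum_(a <- rev (drop (size r - m) r)) a = 1 - \sum_(a <- take (size r - m) r) a.
  rewrite -tot -[X in _ = \sum_(a <- X) a - _](cat_take_drop (size r - m)) big_cat /=.
  rewrite addrAC subrr add0r.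
  by apply: perm_big; rewrite perm_rev.
have := part (size r - m)%N; rewrite add0r !inE => /orP[] /eqP ->.
  by rewrite subr0 eqxx orbT.
by rewrite subrr eqxx.
Qed.

(** For a row followed by a column, the first two conditions are those of a chained tuple and the
    third is the maximal line total. *)
Lemma line_ok_cat s1 s2 :
  reflect [/\ forall m, \sum_(a <- take m s1) a \in [:: 0; 1],
    forall m, \sum_(a <- s1) a + \sum_(a <- take m s2) a \in [:: 0; 1] &
    \sum_(a <- s1) a + \sum_(a <- s2) a = 1]
  (line_ok false (s1 ++ s2)).
Proof.
apply: (iffP (line_okP _ _)); rewrite big_cat /= !add0r.
  move=> [part tot]; split=> // m.
    have := part (minn m (size s1)).
    rewrite add0r takel_cat ?geq_minr //.
    by rewrite take_min take_size.
  have := part (size s1 + m)%N.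
  by rewrite add0r take_cat ltnNge leq_addr /= addKn big_cat.
move=> [part1 part2 tot]; split=> // m; rewrite add0r take_cat.
by case: ifP => _; rewrite ?big_cat; [apply: part1 | apply: part2].
Qed.

Lemma asm_from_cols N us M :
    size us = N -> all (fun r => size r == N) M ->
  asm_from us M = all (line_ok false) M &&
    all (fun j => line_ok (nth false us j) [seq r`_j | r <- M]) (iota 0 N).
Proof.
move=> us_N; elim: M us us_N => [|r M IH] us us_N /=.
  by rewrite -us_N -[in LHS](mkseq_nth false us) all_map.
move=> /andP[/eqP r_N M_N]; rewrite IH //; last by rewrite size_map size_zip us_N r_N minnn.
rewrite -!andbA; congr (_ && _).
rewrite andbCA; congr (_ && _).
have -> : all2 (fun u a => bit u + a \in [:: 0; 1]) us r =
  all (fun j => bit (nth false us j) + r`_j \in [:: 0; 1]) (iota 0 N).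
  rewrite all2E us_N r_N eqxx /=.
  have -> : zip us r = [seq (nth false us j, r`_j) | j <- iota 0 N].
    apply: (@eq_from_nth _ (false, 0)); rewrite size_zip us_N r_N minnn.
      by rewrite size_map size_iota.
    move=> j ltj.
    by rewrite (nth_map 0%N) ?size_iota // nth_iota // nth_zip ?us_N ?r_N.
  by rewrite all_map.
rewrite -all_predI; apply: eq_in_all => j; rewrite mem_iota add0n /= => ltj.
rewrite (nth_map (false, 0)) ?size_zip ?us_N ?r_N ?minnn // nth_zip ?us_N ?r_N //.
Qed.

(** * Chained tuples and their lines *)

Lemma sum_take_ord n (F : 'I_n -> int) (m : 'I_n) :
  \sum_(a <- take m.+1 [seq F j | j : 'I_n]) a = \sum_(j < n | (j <= m)%N) F j.
Proof.
set s := [seq F j | j : 'I_n].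
have s_n : size s = n by rewrite size_map -cardE card_ord.
have sE (j : 'I_n) : s`_j = F j by rewrite (nth_map j) ?size_enum_ord // nth_ord_enum.
under [RHS]eq_bigr do rewrite -sE.
rewrite -(big_mkord (fun j => (j <= m)%N) (fun j => s`_j)).
rewrite (big_nth 0) size_take s_n.
have -> : (if (m.+1 < n)%N then m.+1 else n) = m.+1.
  by case: ltnP => // le; apply/eqP; rewrite eqn_leq le ltn_ord.
rewrite (big_nat_widen _ _ n) //; rewrite [LHS]big_nat_cond [RHS]big_nat_cond.
apply: eq_big => [j|j /andP[_ ltj]]; first by rewrite ltnS.
by rewrite nth_take.
Qed.

Lemma sum_map_ord n (F : 'I_n -> int) :
  \sum_(a <- [seq F j | j : 'I_n]) a = \sum_(j < n) F j.
Proof. by rewrite big_map big_enum. Qed.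

(** Here [m : 'I_n] stands for the prefix of length [m + 1]. The empty prefix is covered by the
    hypothesis on [c], and prefixes longer than n are the whole list. *)
Lemma partial_sumsP n (F : 'I_n -> int) c : c \in [:: 0; 1] ->
  (forall m : 'I_n, c + \sum_(j < n | (j <= m)%N) F j \in [:: 0; 1]) <->
  (forall m, c + \sum_(a <- take m [seq F j | j : 'I_n]) a \in [:: 0; 1]).
Proof.
move=> c01; set s := [seq F j | j : 'I_n].
have s_n : size s = n by rewrite size_map -cardE card_ord.
split=> part m; last by rewrite -sum_take_ord part.
have -> : take m s = take (minn m n) s by rewrite take_min (@take_oversize _ n) ?s_n.
have := geq_minr m n; case: (minn m n) => [|m'] ltm; first by rewrite take0 big_nil addr0.
by rewrite (sum_take_ord F (Ordinal ltm)); apply: part.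
Qed.

Section Lines.
Variables n k : nat.
Implicit Types A B C : k.-tuple 'M[sign_entry]_n.

Definition chain_line A (l : 'I_k) (i : 'I_n) : seq int :=
  [seq entry A (ord_pred l) i j | j : 'I_n] ++
  [seq entry A l (rev_ord j) i | j : 'I_n].

Definition line_sum A (l : 'I_k) (i : 'I_n) : int :=
  \sum_(j < n) entry A (ord_pred l) i j + \sum_(j < n) entry A l (rev_ord j) i.

Lemma row_partial_sumsP A : reflect
  (forall l i m, \sum_(a <- take m [seq entry A l i j | j : 'I_n]) a \in [:: 0; 1])
  (row_partial_sums A).
Proof.
apply: (iffP forallP) => [part l i m|part l].
  move/forallP: (part l) => /(_ i)/forallP part_li; rewrite -[X in X \in _]add0r.
  by move: m; apply/(partial_sumsP (entry A l i)) => // m; rewrite add0r.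
apply/forallP => i; apply/forallP => m; rewrite -[X in X \in _]add0r.
by move: m; apply/(partial_sumsP (entry A l i)) => // m; rewrite add0r.
Qed.

Lemma chained_partial_sumsP A : row_partial_sums A -> reflect
  (forall l i m, \sum_(j < n) entry A (ord_pred l) i j +
     \sum_(a <- take m [seq entry A l (rev_ord j) i | j : 'I_n]) a \in [:: 0; 1])
  (chained_partial_sums A).
Proof.
move=> /row_partial_sumsP rows.
have row_sum l i : \sum_(j < n) entry A (ord_pred l) i j \in [:: 0; 1].
  have := rows (ord_pred l) i n; rewrite take_oversize ?sum_map_ord //.
  by rewrite size_map -cardE card_ord.
apply: (iffP forallP) => [part l i|part l].
  move/forallP: (part l) => /(_ i)/forallP part_li.
  exact/(partial_sumsP (fun j => entry A l (rev_ord j) i)).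
apply/forallP => i; apply/forallP.
exact/(partial_sumsP (fun j => entry A l (rev_ord j) i)).
Qed.

Lemma chain_lineP A :
  chained A && [forall l, forall i, line_sum A l i == 1] =
  [forall l, forall i, line_ok false (chain_line A l i)].
Proof.
apply/andP/forallP => [[/andP[rows chain] sums] l|lines].
  apply/forallP => i; apply/line_ok_cat; rewrite !sum_map_ord; split.
  - by move/row_partial_sumsP: rows; apply.
  - by move/(chained_partial_sumsP rows): chain; apply.
  - exact/eqP/(forallP (forallP sums l)).
have {}lines l i := line_ok_cat _ _ (forallP (lines l) i).
have rows : row_partial_sums A.
  (* The rows of the matrix at [l] begin the lines indexed by [ordS l]. *)
  by apply/row_partial_sumsP => l i m; have [] := lines (ordS l) i; rewrite ordSK.
rewrite /chained rows; split.
  apply/(chained_partial_sumsP rows) => l i m.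
  by have [_] := lines l i; rewrite sum_map_ord.
apply/forallP => l; apply/forallP => i; apply/eqP.
by have [_ _] := lines l i; rewrite !sum_map_ord.
Qed.

Lemma line_sum_in A l i : chained A -> line_sum A l i \in [:: 0; 1].
Proof.
case/andP => rows /(chained_partial_sumsP rows)/(_ l i n).
by rewrite take_oversize ?sum_map_ord // size_map -cardE card_ord.
Qed.

(** Each entry lies on two lines, once in a row part and once in a column part. *)
Lemma sum_line_sum A : \sum_l \sum_i line_sum A l i = total_sum A + total_sum A.
Proof.
rewrite /line_sum; under eq_bigr do rewrite big_split; rewrite big_split /=.
congr (_ + _).
  by rewrite [RHS](reindex (@ord_pred k)) //; exists (@ordS k) => ? _; rewrite ?ord_predK ?ordSK.
apply: eq_bigr => l _; rewrite exchange_big /= [RHS](reindex_inj rev_ord_inj).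
by apply: eq_bigr.
Qed.

(** Line sums are at most 1 and the total is half their sum. Since [B] attains the resulting bound,
    a maximal tuple must attain it on every line. *)
Lemma max_chainedP A B : chained B -> (forall l i, line_sum B l i = 1) ->
  (A \in chained_circular_ASM n k) =
  chained A && [forall l, forall i, line_sum A l i == 1].
Proof.
move=> chB sumB; rewrite inE; apply: andb_id2l => chA.
have tot2 C : chained C -> total_sum C + total_sum C <= \sum_(l < k) \sum_(i < n) 1.
  move=> chC;  rewrite -sum_line_sum; apply: ler_sum => l _; apply: ler_sum => i _.
  by have := line_sum_in l i chC; rewrite !inE => /orP[] /eqP ->.
have totB : total_sum B + total_sum B = \sum_(l < k) \sum_(i < n) 1.
  by rewrite -sum_line_sum; apply: eq_bigr => l _; apply: eq_bigr => i _.
apply/forallP/forallP => [/(_ B)/implyP/(_ chB) le_BA l|all1 C].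
  have le1 l' i : line_sum A l' i <= 1.
    by have := line_sum_in l' i chA; rewrite !inE => /orP[] /eqP ->.
  (* The defects [1 - line_sum A l i] are nonnegative, so their sum being 0 makes each of them 0. *)
  have : \sum_(l < k) \sum_(i < n) (1 - line_sum A l i) == 0.
    under eq_bigr do rewrite sumrB; rewrite sumrB sum_line_sum -totB subr_eq0.
    by have := tot2 A chA; rewrite -totB; move: le_BA; lia.
  rewrite psumr_eq0 => [/allP/(_ l)|l' _]; last by apply: sumr_ge0 => i _; rewrite subr_ge0.
  rewrite mem_index_enum psumr_eq0 => [/(_ isT)/allP sums|i _]; last by rewrite subr_ge0.
  apply/forallP => i; have := sums i; rewrite mem_index_enum => /(_ isT).
  by rewrite subr_eq0 eq_sym.
apply/implyP => /tot2.
have -> : \sum_(l < k) \sum_(i < n) 1 = total_sum A + total_sum A; last by lia.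
rewrite -sum_line_sum; apply: eq_bigr => l _; apply: eq_bigr => i _.
exact/esym/eqP/(forallP (all1 l)).
Qed.

End Lines.

(** * Quadrants of a matrix of size 2n *)

Lemma enum_ord_add (T : Type) m n (F : 'I_(m + n) -> T) :
  [seq F i | i : 'I_(m + n)] =
  [seq F (lshift n i) | i : 'I_m] ++ [seq F (rshift m i) | i : 'I_n].
Proof.
rewrite -[LHS]/(map F (enum 'I_(m + n))).
have -> : enum 'I_(m + n) = map (@lshift m n) (enum 'I_m) ++ map (@rshift m n) (enum 'I_n).
  apply: (inj_map val_inj); rewrite val_enum_ord map_cat iotaD; congr (_ ++ _).
    by rewrite -map_comp -val_enum_ord; apply: eq_map.
  by rewrite -map_comp add0n -[m in LHS]addn0 iotaDl -val_enum_ord -map_comp.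
by rewrite map_cat; congr (_ ++ _); rewrite -map_comp.
Qed.

Lemma map_rev_ord (T : Type) n (F : 'I_n -> T) :
  [seq F (rev_ord i) | i : 'I_n] = rev [seq F i | i : 'I_n].
Proof.
rewrite -[RHS]/(rev (map F (enum 'I_n))) -map_rev.
have -> : rev (enum 'I_n) = map (@rev_ord n) (enum 'I_n); last by rewrite -map_comp.
apply: (inj_map val_inj); rewrite map_rev val_enum_ord.
apply: (@eq_from_nth _ 0%N) => [|i]; rewrite size_rev size_iota.
  by rewrite 2!size_map size_enum_ord.
move=> lti; rewrite nth_rev size_iota // nth_iota; last by lia.
rewrite -map_comp (nth_map (Ordinal lti)) ?size_enum_ord //= nth_enum_ord //; lia.
Qed.

Section Unfold.
Variable n : nat.
Implicit Types A B : 4.-tuple 'M[sign_entry]_n.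

Definition o0 : 'I_4 := @Ordinal 4 0 isT.
Definition o1 : 'I_4 := @Ordinal 4 1 isT.
Definition o2 : 'I_4 := @Ordinal 4 2 isT.
Definition o3 : 'I_4 := @Ordinal 4 3 isT.

(* Row [i] of a matrix continues into column [i] of the next one, read upwards;
   rotating the matrices by successive quarter turns makes these lines straight.
   In the bottom rows and the left columns they are traversed backwards. *)
Definition quadrants A (x y : 'I_(n + n)) : sign_entry :=
  match split x, split y with
  | inl i, inl j => tnth A o0 i j
  | inl i, inr j => tnth A o1 (rev_ord j) i
  | inr i, inr j => tnth A o2 (rev_ord i) (rev_ord j)
  | inr i, inl j => tnth A o3 j (rev_ord i)
  end.

Definition unfold_chain A : (n + n).-tuple ((n + n).-tuple sign_entry) :=
  [tuple [tuple quadrants A x y | y < n + n] | x < n + n].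

Lemma quadrants_ll A i j : quadrants A (lshift n i) (lshift n j) = tnth A o0 i j.
Proof. by rewrite /quadrants !(unsplitK (inl _)). Qed.
Lemma quadrants_lr A i j : quadrants A (lshift n i) (rshift n j) = tnth A o1 (rev_ord j) i.
Proof. by rewrite /quadrants (unsplitK (inl _)) (unsplitK (inr _)). Qed.
Lemma quadrants_rr A i j :
  quadrants A (rshift n i) (rshift n j) = tnth A o2 (rev_ord i) (rev_ord j).
Proof. by rewrite /quadrants !(unsplitK (inr _)). Qed.
Lemma quadrants_rl A i j : quadrants A (rshift n i) (lshift n j) = tnth A o3 j (rev_ord i).
Proof. by rewrite /quadrants (unsplitK (inl _)) (unsplitK (inr _)). Qed.

Lemma forall_ord4 (P : pred 'I_4) : [forall l, P l] = [&& P o0, P o1, P o2 & P o3].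
Proof.
apply/forallP/and4P => [P_ | [P0 P1 P2 P3] [[|[|[|[|//]]]] lt4]]; first by split.
- by rewrite (_ : Ordinal _ = o0) //; apply: val_inj.
- by rewrite (_ : Ordinal _ = o1) //; apply: val_inj.
- by rewrite (_ : Ordinal _ = o2) //; apply: val_inj.
- by rewrite (_ : Ordinal _ = o3) //; apply: val_inj.
Qed.

Lemma unfold_chain_inj : injective unfold_chain.
Proof.
move=> A B eqAB.
have qE x y : quadrants A x y = quadrants B x y.
  have := congr1 (fun M => tnth (tnth M x) y) eqAB.
  by rewrite /unfold_chain !tnth_mktuple.
apply: eq_from_tnth => l; apply/matrixP => i j.
suff : [forall l, tnth A l i j == tnth B l i j] by move/forallP/(_ l)/eqP.
rewrite forall_ord4; apply/and4P; split; apply/eqP.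
- by rewrite -!quadrants_ll.
- by rewrite -[i]rev_ordK -!quadrants_lr.
- by rewrite -[i]rev_ordK -[j]rev_ordK -!quadrants_rr.
- by rewrite -[j]rev_ordK -!quadrants_rl.
Qed.

Lemma unfold_chain_bij : bijective unfold_chain.
Proof.
apply: inj_card_bij; first exact: unfold_chain_inj.
rewrite !card_tuple card_mx -!expnM leq_eqVlt; apply/orP; left; apply/eqP.
congr (_ ^ _)%N; lia.
Qed.

(** The upper rows are the lines of [o1] and the right columns those of [o2]; the lower rows and the
    left columns are the lines of [o3] and [o0] read backwards, which [line_ok_rev] allows. *)
Lemma asm_unfold_chain A :
  asm_from (nseq (n + n) false) [seq map val (val r) | r : (n + n).-tuple _ <- unfold_chain A] =
  [forall l, forall i, line_ok false (chain_line A l i)].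
Proof.
set M := map _ _.
have ME : M = [seq [seq val (quadrants A x y) | y : 'I_(n + n)] | x : 'I_(n + n)].
  rewrite /M -map_comp; apply: eq_map => x /=.
  by rewrite -map_comp.
have colE (y : 'I_(n + n)) : [seq r`_y | r <- M] = [seq val (quadrants A x y) | x : 'I_(n + n)].
  rewrite ME -map_comp; apply: eq_map => x /=.
  by rewrite (nth_map y) ?size_enum_ord // nth_ord_enum.
rewrite (@asm_from_cols (n + n)) ?size_nseq //; last first.
  by rewrite ME; apply/allP => _ /mapP[x _ ->]; rewrite size_map size_enum_ord.
have -> : all (line_ok false) M =
    [forall x, line_ok false [seq val (quadrants A x y) | y : 'I_(n + n)]].
  rewrite ME all_map; apply/allP/forallP => H x; last by move=> _; apply: H.
  by apply: H; rewrite mem_enum.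
have -> : all (fun j => line_ok (nth false (nseq (n + n) false) j) [seq r`_j | r <- M])
      (iota 0 (n + n)) =
    [forall y, line_ok false [seq val (quadrants A x y) | x : 'I_(n + n)]].
  rewrite -val_enum_ord all_map.
  apply/allP/forallP => H y; last by move=> _ /=; rewrite nth_nseq if_same colE; apply: H.
  by have := H y; rewrite mem_enum /= nth_nseq if_same colE; apply.
(* The second half is indexed in reverse to match the numbering of the lines. *)
have split_all (P : pred 'I_(n + n)) :
    [forall x, P x] = [forall i, P (lshift n i)] && [forall i, P (rshift n (rev_ord i))].
  apply/forallP/andP => [H | [/forallP Hl /forallP Hr] x].
    by split; apply/forallP => i.
  by case: (split_ordP x) => i ->; [apply: Hl | rewrite -[i]rev_ordK; apply: Hr].
rewrite !split_all forall_ord4.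
have p0 : ord_pred o0 = o3 by apply: val_inj.
have p1 : ord_pred o1 = o0 by apply: val_inj.
have p2 : ord_pred o2 = o1 by apply: val_inj.
have p3 : ord_pred o3 = o2 by apply: val_inj.
have -> : [forall i, line_ok false [seq val (quadrants A (lshift n i) y) | y : 'I_(n + n)]] =
   [forall i, line_ok false (chain_line A o1 i)].
  apply: eq_forallb => i; congr line_ok; rewrite enum_ord_add /chain_line p1.
  by congr (_ ++ _); apply: eq_map => j; rewrite ?quadrants_ll ?quadrants_lr.
have -> : [forall i, line_ok false
     [seq val (quadrants A (rshift n (rev_ord i)) y) | y : 'I_(n + n)]] =
   [forall i, line_ok false (chain_line A o3 i)].
  apply: eq_forallb => i; rewrite -[RHS]line_ok_rev; congr line_ok.
  rewrite enum_ord_add /chain_line p3 rev_cat -!map_rev_ord.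
  by congr (_ ++ _); apply: eq_map => j; rewrite ?quadrants_rl ?quadrants_rr !rev_ordK.
have -> : [forall i, line_ok false [seq val (quadrants A x (lshift n i)) | x : 'I_(n + n)]] =
   [forall i, line_ok false (chain_line A o0 i)].
  apply: eq_forallb => i; rewrite -[RHS]line_ok_rev; congr line_ok.
  rewrite enum_ord_add /chain_line p0 rev_cat -!map_rev_ord.
  by congr (_ ++ _); apply: eq_map => j; rewrite ?quadrants_ll ?quadrants_rl ?rev_ordK.
have -> : [forall i, line_ok false
     [seq val (quadrants A x (rshift n (rev_ord i))) | x : 'I_(n + n)]] =
   [forall i, line_ok false (chain_line A o2 i)].
  apply: eq_forallb => i; congr line_ok; rewrite enum_ord_add /chain_line p2.
  by congr (_ ++ _); apply: eq_map => j; rewrite ?quadrants_lr ?quadrants_rr ?rev_ordK.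
by do 4?case: [forall i, _].
Qed.

Definition sign0 : sign_entry := @SeqSub _ [:: -1; 0; 1 : int] 0 isT.
Definition sign1 : sign_entry := @SeqSub _ [:: -1; 0; 1 : int] 1 isT.

(* Witnesses that the maximum is reached with all line sums equal to 1. *)
Definition alternating_identity : 4.-tuple 'M[sign_entry]_n :=
  [tuple \matrix_(i, j) (if odd l && (i == j) then sign1 else sign0) | l < 4].

Lemma entry_alternating_identity l i j :
  entry alternating_identity l i j = bit (odd l && (i == j)).
Proof. by rewrite /entry tnth_mktuple mxE; case: ifP. Qed.

Lemma sum_bit_eq (P : pred 'I_n) c i :
  \sum_(j < n | P j) bit (c && (i == j)) = bit (c && P i).
Proof.
rewrite big_mkcond (bigD1 i) //= eqxx andbT big1 ?addr0 => [|j /negbTE ji].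
  by case: c; case: (P i).
by rewrite eq_sym ji andbF if_same.
Qed.

Lemma max_chained_lineP A : (A \in chained_circular_ASM n 4) =
  [forall l, forall i, line_ok false (chain_line A l i)].
Proof.
have rowE (P : pred 'I_n) l i :
    \sum_(j < n | P j) entry alternating_identity l i j = bit (odd l && P i).
  by under eq_bigr do rewrite entry_alternating_identity; rewrite sum_bit_eq.
have colE (P : pred 'I_n) l i :
    \sum_(j < n | P j) entry alternating_identity l (rev_ord j) i =
    bit (odd l && P (rev_ord i)).
  under eq_bigr => j _ do rewrite entry_alternating_identity (can2_eq rev_ordK rev_ordK) eq_sym.
  by rewrite sum_bit_eq.
(* The cycle has even length, so parity alternates across its closing point as well. *)
have odd_pred (l : 'I_4) : odd (ord_pred l) = ~~ odd l.
  by case: l => [[|[|[|[|]]]]].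
rewrite -chain_lineP; apply: (@max_chainedP _ _ A alternating_identity).
  apply/andP; split; apply/forallP => l; apply/forallP => i; apply/forallP => m.
    by rewrite rowE bit_in.
  by rewrite rowE colE odd_pred; case: (odd l); case: (_ <= _)%N.
by move=> l i; rewrite /line_sum rowE colE odd_pred; case: (odd l).
Qed.

Lemma card_chained_circular_ASM (K : comNzRingType) (z : K) :
  Zpart z (nseq (n + n) 1) (nseq (n + n) 1) =
  (z - 1) ^+ ((n + n) * (n + n)) * #|chained_circular_ASM n 4|%:R.
Proof.
rewrite /Zpart Zfrom_ones ?size_nseq //; congr (_ * _).
rewrite (reindex unfold_chain) /=; last exact/onW_bij/unfold_chain_bij.
rewrite -sum1_card natr_sum big_mkcond [RHS]big_mkcond /=; apply: eq_bigr => A _.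
by rewrite max_chained_lineP asm_unfold_chain; case: ifP.
Qed.

End Unfold.

(** * Evaluation of the products *)

Lemma diff_prod_recr e m :
  diff_prod e m.+1 = (diff_prod e m * \prod_(i < m) (e m - e i))%N.
Proof.
rewrite /diff_prod big_ord_recr /= [X in (_ * X)%N]big_pred0 ?muln1 => [|j]; last first.
  by rewrite ltnNge -ltnS ltn_ord.
rewrite -big_split /=; apply: eq_bigr => i _.
by rewrite big_mkcond big_ord_recr -big_mkcond /= ltn_ord.
Qed.

Lemma prod_sub_fact m : (\prod_(i < m) (m - i) = m`!)%N.
Proof.
elim: m => [|m IH]; first by rewrite big_ord0.
by rewrite big_ord_recl subn0 factS -IH.
Qed.

(** The factors of the first product are the numbers from 2 to [3m] not congruent to 1 modulo 3;
    those of the second are the numbers from 3 to [3m + 1] not congruent to 2. Together they form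
    [(3m + 1)!] with the multiples of 3 taken once more. *)
Lemma prod_sub_schur_exp m :
  ((\prod_(i < m + m) (3 * m - schur_exp i)) * \prod_(i < m + m) (3 * m + 1 - schur_exp i)
   = (3 * m + 1)`! * 3 ^ m * m`!)%N.
Proof.
elim: m => [|m IH]; first by rewrite !big_ord0.
(* Prolonging the product by two places shifts the exponents by 3, leaving only the factors for the
   exponents 0 and 1 as new. *)
have shift c : (\prod_(i < m.+1 + m.+1) (c + 3 - schur_exp i) =
    (c + 3) * (c + 2) * \prod_(i < m + m) (c - schur_exp i))%N.
  rewrite addnS addSn 2!big_ord_recl mulnA.
  congr (_ * _ * _)%N; rewrite /schur_exp /= /bump /=; first by lia.
    by lia.
  by apply: eq_bigr => i _; lia.
have -> : (3 * m.+1 = 3 * m + 3)%N by lia.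
have -> : (3 * m + 3 + 1 = (3 * m + 1) + 3)%N by lia.
rewrite !shift mulnACA IH !factS expnS.
have -> : (3 * m + 1 + 3 = (3 * m + 1).+3)%N by lia.
rewrite !factS; nia.
Qed.

(** Induction on m, adding two exponents at a time: [id] gains [(2m)!] and [(2m + 1)!], and
    [schur_exp] gains the two products of [prod_sub_schur_exp] and the difference 1 between the two
    new exponents. *)
Lemma diff_prod_fact m :
  (diff_prod schur_exp (m + m) * \prod_(k < m) (m + k)`! =
   \prod_(k < m) (3 * k + 1)`! * 3 ^ 'C(m, 2) * diff_prod id (m + m))%N.
Proof.
elim: m => [|m IH].
  by rewrite /diff_prod !big_ord0.
(* The extra [m!] completes the product of the [(m + 1 + k)!] at its lower end, so that it prolongs
   that of the [(m + k)!]; it also matches the [m!] of [prod_sub_schur_exp]. *)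
apply/eqP; rewrite -(eqn_pmul2r (fact_gt0 m)) -mulnA.
have -> : (\prod_(k < m.+1) (m.+1 + k)`! * m`! =
   \prod_(k < m) (m + k)`! * (m + m)`! * (m + m).+1`!)%N.
  transitivity (\prod_(k < m.+2) (m + k)`!)%N.
    rewrite [RHS]big_ord_recl addn0 mulnC; congr (_ * _)%N; apply: eq_bigr => k _.
    by rewrite /= /bump /= addnA addn1.
  by rewrite 2!big_ord_recr /= addnS.
rewrite addnS addSn !diff_prod_recr.
have -> : (\prod_(i < (m + m).+1) (schur_exp (m + m).+1 - schur_exp i) =
   \prod_(i < m + m) (3 * m + 1 - schur_exp i))%N.
  rewrite big_ord_recr /= [X in (_ * X)%N](_ : _ = 1%N) ?muln1; last by rewrite /schur_exp; lia.
  by apply: eq_bigr => i _; rewrite /schur_exp; lia.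
have -> : (\prod_(i < m + m) (schur_exp (m + m) - schur_exp i) =
   \prod_(i < m + m) (3 * m - schur_exp i))%N.
  by apply: eq_bigr => i _; rewrite /schur_exp; lia.
rewrite !prod_sub_fact big_ord_recr /= binS bin1 expnD.
move: (prod_sub_schur_exp m) IH.
set a := \prod_(i < _) _; set b := \prod_(i < _) _; set c := diff_prod _ _.
set d := diff_prod _ _; set e := \prod_(k < m) _; set f := \prod_(k < m) _.
move=> ab IH; apply/eqP.
transitivity (c * e * (a * b) * (m + m)`! * (m + m).+1`!)%N; first by ring.
by rewrite IH ab; ring.
Qed.

(** The relation gives [- z * 3 = (z - 1) ^+ 2], so the power of 3 turns each factor [- z] of
    [Zconst] into a square of [z - 1]. *)
Lemma Zconst_pow (K : fieldType) (z : K) m : z ^+ 2 + z + 1 = 0 ->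
  Zconst z m * 3 ^+ 'C(m, 2) = (z - 1) ^+ (m * m).
Proof.
move=> z_root; elim: m => [|m IH]; first by rewrite mulr1.
rewrite binS bin1 exprD /=.
have sq : - z * 3 = (z - 1) ^+ 2.
  by transitivity ((z - 1) ^+ 2 - (z ^+ 2 + z + 1)); [ring | rewrite z_root subr0].
transitivity ((z - 1) * (- z * 3) ^+ m * (Zconst z m * 3 ^+ 'C(m, 2))).
  by rewrite exprMn; ring.
rewrite IH sq -exprM -exprS -exprD; congr (_ ^+ _); lia.
Qed.

(** Compares the two values of the partition function with all parameters 1, by counting and by
    alternants, at a primitive cube root of unity. [Zconst_pow] lets [Zconst] cancel, and only
    natural numbers remain. *)
Lemma card_ASM_diff_prod n : let N := (n + n)%N in
  (#|chained_circular_ASM n 4| * 3 ^ 'C(N, 2) * diff_prod id (N + N) =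
   diff_prod schur_exp (N + N))%N.
Proof.
move=> N.
have [z z_prim] := C_prim_root_exists (isT : (0 < 3)%N).
have z1 : z != 1 by rewrite -[z]expr1 -(prim_order_dvd z_prim).
have z_root : z ^+ 2 + z + 1 = 0.
  have : (z - 1) * (z ^+ 2 + z + 1) = 0.
    by rewrite -(subrr 1) -{3}(prim_expr_order z_prim); ring.
  by move/eqP; rewrite mulf_eq0 subr_eq0 (negPf z1) => /eqP.
have C0 : Zconst z N != 0.
  have := expf_neq0 (N * N) (_ : z - 1 != 0); rewrite -Zconst_pow // mulf_eq0 negb_or subr_eq0.
  by case/(_ z1)/andP.
have := Zpart_ones z_root N; rewrite card_chained_circular_ASM -Zconst_pow // -!mulrA.
move=> /(mulfI C0) /eqP; rewrite -natrX -!natrM eqr_nat => /eqP <-.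
by rewrite mulnA [(#|_| * _)%N]mulnC.
Qed.

Theorem corollary4p12 (n : nat) (hn : (1 <= n)%N) :
  #|chained_circular_ASM n 4|%:R =
    \prod_(0 <= k < (2 * n)%N)
      (((3 * k + 1)`!)%:R / ((2 * n + k)`!)%:R) :> rat.
Proof.
have -> : (2 * n = n + n)%N by lia.
rewrite big_mkord prodf_div -!natr_prod; set N := (n + n)%N.
have F0 : (0 < \prod_(k < N) (N + k)`!)%N by apply: prodn_gt0 => k; apply: fact_gt0.
apply: (canRL (mulfK _)); first by rewrite pnatr_eq0 -lt0n.
have V0 : (0 < diff_prod id (N + N))%N.
  apply: prodn_gt0 => i; apply: prodn_cond_gt0 => j lt_ij; by rewrite subn_gt0.
apply/eqP; rewrite -natrM eqr_nat.
(* With denominators cleared, multiplying by this positive number brings both sides to the form of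
   [diff_prod_fact] and [card_ASM_diff_prod]. *)
have pos : (0 < 3 ^ 'C(N, 2) * diff_prod id (N + N))%N by rewrite muln_gt0 expn_gt0 V0.
rewrite -(eqn_pmul2r pos) !mulnA -diff_prod_fact -card_ASM_diff_prod; apply/eqP.
by rewrite -/N; ring.
Qed.
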